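(* For every integer $r$ with $1\leq r\leq d_1$: $p(r;2)=1$ if $r\leq (d_1+1)/2$, and $p(r;2)=0$ if $r>(d_1+1)/2$. More precisely, for $r\leq (d_1+1)/2$ the only word $w$ of length $r$ such that $w^2$ is a factor of $\mathbf{s}$ is $w=a_1^r$, and for $(d_1+1)/2<r\leq d_1$ there is no such word.
   Context: Fix $k\geq 2$ and the alphabet $\mathcal{A}_k=\{a_1,\dots,a_k\}$. An infinite word $\mathbf{t}$ is standard episturmian with directive word $x_1x_2x_3\cdots$ ($x_i$ letters) if its palindromic prefixes $u_1=\varepsilon,u_2,\dots$ satisfy $u_{n+1}=(u_nx_n)^{(+)}$, where $w^{(+)}$ is the shortest palindrome having $w$ as a prefix, and $\mathbf{t}=\lim_n u_n$. Let $(d_i)_{i\geq1}$ be positive integers and let $\mathbf{s}$ be the standard episturmian word with directive word $a_1^{d_1}a_2^{d_2}\cdots a_k^{d_k}a_1^{d_{k+1}}a_2^{d_{k+2}}\cdots a_k^{d_{2k}}a_1^{d_{2k+1}}\cdots$. For integers $m\geq1$, $l\geq 2$, $p(m;l)$ denotes the number of words $w$ with $|w|=m$ such that $w^l$ is a factor of $\mathbf{s}$. *)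

(* Defs.v *)
From mathcomp Require Import all_boot.
From mathcomp Require Import boolp.

Set Implicit Arguments.
Unset Strict Implicit.
Unset Printing Implicit Defensive.

(* All sequences are indexed from 0: the terms x 0, u 0, d 0 of the sequences
   below stand for x_1, u_1, d_1, and the letter a_i is the ordinal i - 1. *)

Section Words.
Variable A : eqType.
Implicit Types (v w p : seq A) (t x : nat -> A) (u : nat -> seq A).

Definition palindrome w : Prop := rev w = w.

Definition iprefix v t : Prop := v = mkseq t (size v).

Definition factor v t : Prop :=
  exists i, v = mkseq (fun j => t (i + j)) (size v).

Definition wpow w l : seq A := flatten (nseq l w).

(* p = w^(+) *)
Definition pal_closure w p : Prop :=
  [/\ palindrome p, prefix w p &
      forall q, palindrome q -> prefix w q -> size p <= size q].

Definition word_lim u t : Prop :=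
  forall m, exists N, forall n, N <= n -> prefix (mkseq t m) (u n).

Definition standard_episturmian x t : Prop :=
  exists u,
    [/\ forall v, (palindrome v /\ iprefix v t) <-> exists n, v = u n,
        u 0 = [::],
        forall n, pal_closure (rcons (u n) (x n)) (u n.+1) &
        word_lim u t].

End Words.

(* The letter a_(i+1), with i read modulo k. *)
Definition letter k (hk : 1 < k) (i : nat) : 'I_k :=
  Ordinal (ltn_pmod i (ltnW hk)).

(* x = a_1^(d_1) a_2^(d_2) ... a_k^(d_k) a_1^(d_(k+1)) ... : every finite
   product of initial blocks is a prefix of x. *)
Definition cyclic_directive k (hk : 1 < k) (d : nat -> nat) (x : nat -> 'I_k) :
    Prop :=
  forall n, iprefix (flatten (mkseq (fun i => nseq (d i) (letter hk i)) n)) x.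

(* p(m;l) *)
Definition npowers k (s : nat -> 'I_k) (m l : nat) : nat :=
  #|[set w : m.-tuple 'I_k | `[< factor (wpow w l) s >]]|.

(* The following facts justify speaking of "the" word with a given
   directive word. *)

Lemma pal_closure_ex (A : eqType) (w : seq A) : exists p, pal_closure w p.
Proof.
have e0 : exists n, `[< exists p, [/\ palindrome p, prefix w p & size p = n] >].
  exists (size (w ++ rev w)); apply/asboolP; exists (w ++ rev w).
  by split; rewrite ?prefix_prefix // /palindrome rev_cat revK.
case: (ex_minnP e0) => n /asboolP[p [p1 p2 p3]] hn.
exists p; split=> // q q1 q2; rewrite p3; apply: hn.
by apply/asboolP; exists q.
Qed.

Lemma pal_closure_uniq (A : eqType) (w p q : seq A) :
  pal_closure w p -> pal_closure w q -> p = q.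
Proof.
move=> [p1 p2 p3] [q1 q2 q3].
have szE : size p = size q by apply/eqP; rewrite eqn_leq p3 ?q3.
have le2 : size p <= (size w).*2.
  rewrite -addnn -[X in _ + X]size_rev -size_cat.
  by apply: p3; rewrite ?prefix_prefix // /palindrome rev_cat revK.
case/prefixP: p2 => p' pE; case/prefixP: q2 => q' qE.
case: w => [|a w'] in p3 q3 le2 pE qE *.
  by move: le2 szE; rewrite leqn0 => /nilP-> /esym/size0nil->.
set w := a :: w' in p3 q3 le2 pE qE *.
apply: (@eq_from_nth _ a) => // i ip.
case: (ltnP i (size w)) => iw; first by rewrite pE qE !nth_cat iw.
have jw : size p - i.+1 < size w.
  rewrite ltn_subLR //; apply: leq_ltn_trans le2 _; rewrite -addnn.
  by rewrite ltn_add2r.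
rewrite -p1 -q1 !nth_rev -?szE //.
by rewrite {1}pE qE !nth_cat jw.
Qed.

Lemma standard_episturmian_ex (A : eqType) (x : nat -> A) :
  exists t, standard_episturmian x t.
Proof.
pose pc w := sval (cid (pal_closure_ex (A:=A) w)).
have pcP w : pal_closure w (pc w) by rewrite /pc; case: cid.
pose u := fix F n := if n is m.+1 then pc (rcons (F m) (x m)) else [::].
have uS n : pal_closure (rcons (u n) (x n)) (u n.+1) by exact: pcP.
have pu n m : n <= m -> prefix (u n) (u m).
  elim: m => [|m IH]; first by rewrite leqn0 => /eqP->; exact: prefix_refl.
  rewrite leq_eqVlt => /orP[/eqP->|]; first exact: prefix_refl.
  rewrite ltnS => /IH h.
  apply: prefix_trans h _; have [_ h _] := uS m.
  exact: prefix_trans (prefix_rcons _ _) h.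
have su n : n <= size (u n).
  elim: n => // n IH; have [_ /size_prefix h _] := uS n.
  by apply: leq_trans h; rewrite size_rcons.
pose t n := nth (x 0) (u n.+1) n.
have tP n : iprefix (u n) t.
  apply: (@eq_from_nth _ (x 0)) => [|i iu]; rewrite ?size_mkseq // nth_mkseq //.
  rewrite /t; case: (leqP n i.+1) => [/pu|/ltnW/pu] /prefixP[r ->];
    by rewrite nth_cat ?iu // su.
exists t, u; split=> // [v|m].
  split=> [[v1 v2]|[n ->]]; last first.
    by split=> //; case: n => // n; case: (uS n).
  have /ex_minnP[n hn nm] : exists n, size v <= size (u n).
    by exists (size v).
  exists n.
  have pre a b : a <= b -> prefix (mkseq t a) (mkseq t b).
    move=> ab; apply/prefixP; exists (drop a (mkseq t b)).
    rewrite -{1}(cat_take_drop a (mkseq t b)); congr (_ ++ _).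
    by rewrite /mkseq -map_take take_iota (minn_idPl ab).
  suff e : size v = size (u n) by rewrite v2 e -tP.
  apply/eqP; rewrite eqn_leq hn /=.
  case: n hn nm => [|n] hn nm //.
  have [_ h3 h] := uS n; apply: h => //.
  have lt : size (u n) < size v by rewrite ltnNge; apply/negP => /nm; rewrite ltnn.
  have -> : rcons (u n) (x n) = mkseq t (size (u n)).+1.
    case/prefixP: h3 => r hr.
    have hl : (size (u n)).+1 <= size (u n.+1).
      by rewrite hr size_cat size_rcons leq_addr.
    have := pre _ _ hl; rewrite -tP hr prefixE => /eqP.
    by rewrite size_mkseq -(size_rcons (u n) (x n)) take_size_cat.
  by rewrite v2; apply: pre.
exists m => n mn.
have lm : m <= size (u n) by apply: leq_trans mn (su n).
rewrite (tP n) prefixE size_mkseq /mkseq -map_take take_iota.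
by rewrite (minn_idPl lm).
Qed.

Lemma standard_episturmian_uniq (A : eqType) (x t t' : nat -> A) :
  standard_episturmian x t -> standard_episturmian x t' -> t =1 t'.
Proof.
move=> [u [_ u0 uS ut]] [v [_ v0 vS vt]] m.
have uv n : u n = v n.
  elim: n => [|n IH]; first by rewrite u0.
  by apply: pal_closure_uniq (uS n) _; rewrite IH.
have [N hN] := ut m.+1; have [N' hN'] := vt m.+1.
have := hN _ (leq_maxl N N'); have := hN' _ (leq_maxr N N').
rewrite -uv !prefixE !size_mkseq => /eqP-> /eqP e.
have : nth (t m) (mkseq t m.+1) m = nth (t m) (mkseq t' m.+1) m by rewrite e.
by rewrite !nth_mkseq.
Qed.

Lemma cyclic_directive_ex k (hk : 1 < k) (d : nat -> nat) :
  (forall i, 0 < d i) -> exists x, cyclic_directive hk d x.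
Proof.
move=> d_gt0.
pose F n := flatten (mkseq (fun i => nseq (d i) (letter hk i)) n).
have FS n : F n.+1 = F n ++ nseq (d n) (letter hk n).
  by rewrite /F mkseqS -cats1 flatten_cat /= cats0.
have sF n : n <= size (F n).
  by elim: n => // n IH; rewrite FS size_cat size_nseq -addn1 leq_add.
have pF n m : n <= m -> prefix (F n) (F m).
  elim: m => [|m IH]; first by rewrite leqn0 => /eqP->; exact: prefix_refl.
  rewrite leq_eqVlt => /orP[/eqP->|]; first exact: prefix_refl.
  rewrite ltnS => /IH h.
  by apply: prefix_trans h _; rewrite FS prefix_prefix.
exists (fun i => nth (letter hk 0) (F i.+1) i) => n; rewrite -/(F n).
apply: (@eq_from_nth _ (letter hk 0)) => [|i iF]; rewrite ?size_mkseq //.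
rewrite nth_mkseq //.
by case: (leqP n i.+1) => [/pF|/ltnW/pF] /prefixP[r ->]; rewrite nth_cat ?iF // sF.
Qed.

(* Main.v *)
Require Import Defs.
From mathcomp Require Import all_boot.
From mathcomp Require Import boolp zify.

Set Implicit Arguments.
Unset Strict Implicit.
Unset Printing Implicit Defensive.

(* Write a = a_1 and d = d_1.  In s two occurrences of letters other than a are
   at distance greater than d, the longest run of a has length d + 1, and this
   length is attained.  If |w| = r <= d and w^2 is a factor, then a letter of w
   other than a would occur twice at distance r; so w = a^r, and 2r <= d + 1.
   The two bounds pass from the palindromic prefix u_n to u_(n+1) because
   u_(n+1) is covered by u_n x_n and its mirror image, which overlap in at
   least d + 1 letters when x_n = a, and at least in the letter x_n otherwise. *)

(** * Gaps and runs in a prefix and their passage to a longer palindromic prefix *)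

Definition palindromic_upto (A : Type) (t : nat -> A) (N : nat) : Prop :=
  forall i j, (i + j).+1 = N -> t i = t j.

Definition sparse_upto (A : eqType) (a : A) (d : nat) (t : nat -> A) (N : nat) :
    Prop :=
  forall i j, i < j -> j < N -> t i != a -> t j != a -> i + d < j.

(** The window from [i] to [i + d.+1] has d + 2 letters, so runs of [a] are bounded by d + 1. *)
Definition short_runs_upto (A : eqType) (a : A) (d : nat) (t : nat -> A)
    (N : nat) : Prop :=
  forall i, i + d.+1 < N -> exists2 j, i <= j <= i + d.+1 & t j != a.

Lemma palindromic_suffix (A : eqType) (a : A) d t N i :
    (forall i, i < d -> t i = a) -> palindromic_upto t N ->
  N <= i + d -> i < N -> t i = a.
Proof.
move=> ha palN hi iN; rewrite (palN i (N - i.+1)); last lia.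
by apply: ha; lia.
Qed.

(** Here [N] and [M] play the lengths of u_n and u_(n+1). The first N + 1 letters and their mirror
    image in [M] cover the prefix of length [M]; only a pair with one position on each side of the
    overlap needs an argument. *)
Lemma sparse_upto_step (A : eqType) (a : A) d t N M :
    (forall i, i < d -> t i = a) ->
    palindromic_upto t N -> palindromic_upto t M ->
    N < M -> M <= N.*2.+1 -> (t N = a -> M + d <= N.*2.+1) ->
  sparse_upto a d t N -> sparse_upto a d t M.
Proof.
move=> ha palN palM NM M2 hM spN.
have spSN : sparse_upto a d t N.+1.
  move=> i j ij jN ti tj; case: (ltnP j N) => [jN'|Nj]; first exact: spN.
  rewrite ltnNge; apply/negP => h.
  by case/eqP: ti; apply: (palindromic_suffix ha palN); lia.
move=> i j ij jM ti tj; case: (leqP j N) => [jN|Nj]; first exact: spSN.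
case: (leqP M (i + N.+1)) => Mi.
  have ti' : t (M - i.+1) != a by rewrite -(palM i) //; lia.
  have tj' : t (M - j.+1) != a by rewrite -(palM j) //; lia.
  by have := spSN (M - j.+1) (M - i.+1) ltac:(lia) ltac:(lia) tj' ti'; lia.
(* The pair straddles the overlap: either the overlap alone has at least d + 1 letters, or position
   [N] carries a letter other than [a] and already lies more than [d] after [i]. *)
have [tN|tN] := eqVneq (t N) a; first by have := hM tN; lia.
case: (ltnP i N) => [iN|]; last lia.
by have := spSN i N iN (ltnSn N) ti tN; lia.
Qed.

Lemma short_runs_upto_step (A : eqType) (a : A) d t N M :
    palindromic_upto t N -> palindromic_upto t M ->
    N < M -> M <= N.*2.+1 ->
    (t N = a -> [/\ M + d <= N.*2.+1, d < N & t d != a]) ->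
  short_runs_upto a d t N -> short_runs_upto a d t M.
Proof.
move=> palN palM NM M2 hM srN.
have srSN : short_runs_upto a d t N.+1.
  move=> i iN; case: (ltnP (i + d.+1) N) => [|Ni]; first exact: srN.
  have [tN|tN] := eqVneq (t N) a; last by exists N => //; lia.
  (* The window ends at [N], so [i] is the mirror image of [d] in the palindrome of length [N]. *)
  by have [_ dN td] := hM tN; exists i; rewrite ?(palN i d) //; lia.
move=> i iM; case: (leqP (i + d.+1) N) => iN; first exact: srSN.
case: (leqP M (i + N.+1)) => Mi.
  have [|j hj tj] := srSN (M - (i + d.+1).+1); first lia.
  by exists (M - j.+1); rewrite -?(palM j (M - j.+1)) //; lia.
(* Such a window would strictly contain the overlap, which is too long for that if [t N] is [a];
   otherwise the window contains [N]. *)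
have [tN|tN] := eqVneq (t N) a; first by have [] := hM tN; lia.
by exists N => //; lia.
Qed.

(** The word v z rev(v) is a palindrome that extends v z. *)
Lemma pal_closure_size_suffix (A : eqType) (v z p : seq A) :
  palindrome z -> pal_closure (v ++ z) p -> size p <= (size v).*2 + size z.
Proof.
move=> zpal [_ _ pmin].
have -> : (size v).*2 + size z = size ((v ++ z) ++ rev v).
  by rewrite !size_cat size_rev; lia.
by apply: pmin; rewrite ?prefix_prefix // /palindrome !rev_cat revK zpal catA.
Qed.

Lemma mkseq_catD (A : Type) (t : nat -> A) m n :
  mkseq t (m + n) = mkseq t m ++ mkseq (fun i => t (m + i)) n.
Proof.
by rewrite /mkseq iotaD map_cat add0n -{2}[m]addn0 iotaDl -map_comp.
Qed.

Lemma mkseq_nseq (A : Type) (a : A) t n :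
  (forall i, i < n -> t i = a) -> mkseq t n = nseq n a.
Proof.
move=> h; apply: (@eq_from_nth _ a); rewrite size_mkseq ?size_nseq // => i hi.
by rewrite nth_mkseq // nth_nseq hi h.
Qed.

Lemma palindrome_mkseq (A : eqType) (t : nat -> A) N :
  palindrome (mkseq t N) -> palindromic_upto t N.
Proof.
move=> pal i j ijN.
have := congr1 (fun w => nth (t 0) w i) pal.
rewrite nth_rev size_mkseq ?nth_mkseq; try lia.
by have -> : N - i.+1 = j by lia.
Qed.

Lemma cyclic_directive_nth k (hk : 1 < k) d x n :
  cyclic_directive hk d x ->
  forall i, i < d n -> x (sumn (mkseq d n) + i) = letter hk n.
Proof.
move=> hx i hi.
have szF : size (flatten (mkseq (fun i => nseq (d i) (letter hk i)) n))
           = sumn (mkseq d n).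
  by rewrite size_flatten /shape /mkseq -map_comp; congr sumn;
     apply: eq_map => j /=; rewrite size_nseq.
have := hx n.+1; rewrite mkseqS -cats1 flatten_cat /iprefix size_cat szF.
rewrite [flatten [:: _]]cats0 size_nseq.
move/(congr1 (fun w => nth (letter hk n) w (sumn (mkseq d n) + i))).
rewrite nth_cat szF ltnNge leq_addr /= addKn nth_nseq hi nth_mkseq //.
by rewrite ltn_add2l.
Qed.

Section FirstLetter.
Variables (A : eqType) (a : A) (d : nat) (x s : nat -> A).
Hypothesis x_a : forall i, i < d -> x i = a.
Hypothesis x_d : x d != a.
Hypothesis hs : standard_episturmian x s.

(** This replaces the words u_n by their lengths, so that the rest is arithmetic on positions of
    [s]. *)
Lemma palindromic_prefix_sizes : exists N : nat -> nat,
  [/\ N 0 = 0, forall n, N n < N n.+1, forall n, palindromic_upto s (N n),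
      forall n, s (N n) = x n &
      forall n (v z : seq A), palindrome z -> mkseq s (N n).+1 = v ++ z ->
        N n.+1 <= (size v).*2 + size z].
Proof.
have [u [hu u0 uS _]] := hs.
have up n : palindrome (u n) /\ iprefix (u n) s by apply/hu; exists n.
have rE n : size (u n) < size (u n.+1) /\
    rcons (u n) (x n) = mkseq s (size (u n)).+1.
  have [_ /prefixP[z hz] _] := uS n.
  have hl : (size (u n)).+1 <= size (u n.+1).
    by rewrite hz size_cat size_rcons leq_addr.
  split=> //; have := (up n.+1).2; rewrite /iprefix {1}hz.
  rewrite -(subnKC hl) mkseq_catD => /eqP.
  by rewrite eqseq_cat ?size_rcons ?size_mkseq // => /andP[/eqP].
exists (fun n => size (u n)); split=> [|n|n|n|n v z zpal vz].
- by rewrite u0.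
- exact: (rE n).1.
- by apply: palindrome_mkseq; rewrite -(up n).2; case: (up n).
- have := (rE n).2; rewrite mkseqS => /eqP; rewrite eqseq_rcons.
  by case/andP=> _ /eqP.
- by apply: pal_closure_size_suffix => //; rewrite -vz -(rE n).2.
Qed.

Lemma episturmian_runs :
  [/\ forall N, sparse_upto a d s N,
      forall N, short_runs_upto a d s N &
      forall n, d <= n -> x n = a -> exists i, forall j, j <= d -> s (i + j) = a].
Proof.
have [N [N0 NS Npal sN Nmin]] := palindromic_prefix_sizes.
have leN n : n <= N n by elim: n => // n IH; have := NS n; lia.
have Nd n : n <= d -> N n = n /\ (forall i, i < n -> s i = a).
  elim: n => [|n IH] nd; first by rewrite N0.
  have [Nn sa] := IH (ltnW nd).
  have sa' i : i < n.+1 -> s i = a.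
    rewrite ltnS leq_eqVlt => /orP[/eqP->|]; last exact: sa.
    by rewrite -{1}Nn sN x_a.
  (* The word a^(n+1) is its own palindromic closure. *)
  split=> //; have := Nmin n [::] (nseq n.+1 a).
  rewrite Nn (mkseq_nseq sa') size_nseq /palindrome rev_nseq => h.
  by have := h erefl erefl; have := leN n.+1; rewrite /=; lia.
have [Ndd sa] := Nd d (leqnn d).
have sd : s d != a by rewrite -{1}Ndd sN.
have suffix n i : N n <= i + d -> i < N n -> s i = a.
  exact: (palindromic_suffix sa (Npal n)).
have bound1 n : N n.+1 <= (N n).*2.+1.
  have := Nmin n (mkseq s (N n)) [:: s (N n)].
  by rewrite size_mkseq cats1 -mkseqS addn1 => h; apply: h.
have bound2 n : d <= n -> s (N n) = a -> N n.+1 + d <= (N n).*2.+1.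
  move=> dn sNa; have dN : d <= N n by apply: leq_trans dn (leN n).
  (* The last [d] letters of u_n mirror its first [d], so u_n x_n ends in the palindrome a^(d+1). *)
  have := Nmin n (mkseq s (N n - d)) (nseq d.+1 a).
  rewrite size_mkseq size_nseq /palindrome rev_nseq => h.
  have {h} := h erefl _; rewrite -(@mkseq_nseq _ a (fun i => s (N n - d + i))).
    by rewrite -mkseq_catD; have -> : N n - d + d.+1 = (N n).+1 by [lia];
       move=> /(_ erefl); lia.
  move=> i; rewrite ltnS leq_eqVlt => /orP[/eqP->|id]; first by rewrite subnK.
  by apply: (suffix n); lia.
have good n : d <= n -> sparse_upto a d s (N n) /\ short_runs_upto a d s (N n).
  (* The induction starts at u_d = a^d, where both bounds are vacuous. *)
  move/subnKC <-; elim: (n - d) => [|m [IH1 IH2]].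
    rewrite addn0 Ndd; split=> [i j ij jd|i]; last lia.
    by rewrite sa ?eqxx //; lia.
  rewrite addnS; split.
    apply: (sparse_upto_step sa (Npal (d + m)) (Npal _) (NS _)) => //.
    by apply: bound2; lia.
  apply: (short_runs_upto_step (Npal (d + m)) (Npal _) (NS _)) => // sNa.
  split=> //; first by apply: bound2 => //; lia.
  (* The letter x_d is not [a], so n > d and u_n is longer than [d]. *)
  case: m {IH1 IH2} sNa => [|m] sNa.
    by move: sd; rewrite -{1}Ndd -[d in N d]addn0 sNa eqxx.
  by have := leN (d + m.+1); lia.
split.
- move=> M i j ij jM; have [g _] := good (d + M) (leq_addr _ _).
  by apply: g => //; have := leN (d + M); lia.
- move=> M i iM; have [_ g] := good (d + M) (leq_addr _ _).
  by apply: g; have := leN (d + M); lia.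
(* The run consists of the last [d] letters of u_n and of x_n. *)
- move=> n dn xn; exists (N n - d) => j; have := leN n => nN.
  rewrite leq_eqVlt => /orP[/eqP->|jd]; first by rewrite subnK ?sN //; lia.
  by apply: (suffix n); lia.
Qed.

End FirstLetter.

(** * Squares of short words *)

Lemma factorP (A : eqType) (v : seq A) (t : nat -> A) (a : A) :
  factor v t <-> exists i, forall j, j < size v -> t (i + j) = nth a v j.
Proof.
split=> [[i vE]|[i h]]; exists i.
  by move=> j jv; rewrite vE nth_mkseq.
apply: (@eq_from_nth _ a); rewrite ?size_mkseq // => j jv.
by rewrite nth_mkseq ?h.
Qed.

Lemma square_factorP (A : eqType) (a : A) d (t : nat -> A) (w : seq A) :
    (forall N, sparse_upto a d t N) -> (forall N, short_runs_upto a d t N) ->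
    (exists i, forall j, j <= d -> t (i + j) = a) -> 0 < size w <= d ->
  factor (wpow w 2) t <-> w = nseq (size w) a /\ 2 * size w <= d + 1.
Proof.
move=> sp sr [i0 run] /andP[w0 wd].
rewrite /wpow /= cats0 (factorP _ _ a) size_cat; split.
  case=> i h.
  have wa j : j < size w -> nth a w j = a.
    move=> jw; apply: contraTeq (wd) => na.
    have h1 : t (i + j) = nth a w j by rewrite h ?nth_cat ?jw //; lia.
    have h2 : t (i + (size w + j)) = nth a w j.
      by rewrite h ?nth_cat ?ltnNge ?leq_addr ?addKn //; lia.
    have := sp (i + (size w + j)).+1 (i + j) (i + (size w + j)).
    rewrite h1 h2 => /(_ ltac:(lia) ltac:(lia) na na); lia.
  have wE : w = nseq (size w) a.
    apply: (@eq_from_nth _ a); rewrite ?size_nseq // => j jw.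
    by rewrite wa // nth_nseq jw.
  split=> //; rewrite leqNgt; apply/negP => dw.
  (* The first d + 2 letters of w^2 would all be [a]. *)
  have [j hj] := sr (i + d.+1).+1 i (ltnSn _).
  have -> : t j = t (i + (j - i)) by congr t; lia.
  by rewrite h; [rewrite wE -nseqD nth_nseq if_same eqxx | lia].
case=> wE dw; exists i0 => j jw.
by rewrite wE -nseqD nth_nseq if_same run //; lia.
Qed.

Theorem theorem6p12 (k : nat) (hk : 1 < k)
    (d : nat -> nat) (hd : forall i : nat, 0 < d i)
    (x : nat -> 'I_k) (hx : cyclic_directive hk d x)
    (s : nat -> 'I_k) (hs : standard_episturmian x s)
    (r : nat) (hr : 1 <= r <= d 0) :
  (2 * r <= d 0 + 1 ->
     npowers s r 2 = 1 /\
     (forall w : seq 'I_k,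
        (size w = r /\ factor (wpow w 2) s) <-> w = nseq r (letter hk 0))) /\
  (d 0 + 1 < 2 * r ->
     npowers s r 2 = 0 /\
     (forall w : seq 'I_k, size w = r -> ~ factor (wpow w 2) s)).
Proof.
have xn := cyclic_directive_nth hx.
have x0 i : i < d 0 -> x i = letter hk 0 by move=> /(xn 0); rewrite add0n.
have x1 : x (d 0) != letter hk 0.
  have /= := xn 1 0 (hd 1); rewrite !addn0 => ->.
  by apply/negP => /eqP/(congr1 val) /=; rewrite mod0n modn_small.
(* The block with index [k] is again a power of a_1; this later occurrence in the directive word
   produces the run of length d + 1. *)
have xk : x (sumn (mkseq d k)) = letter hk 0.
  rewrite -[sumn _]addn0 xn //; apply/val_inj.
  by rewrite /= modnn mod0n.
have dk : d 0 <= sumn (mkseq d k).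
  by rewrite -(prednK (ltnW hk)) /= leq_addr.
have [sp sr /(_ _ dk xk) run] := episturmian_runs x0 x1 hs.
have sq w : size w = r -> factor (wpow w 2) s <->
    w = nseq r (letter hk 0) /\ 2 * r <= d 0 + 1.
  by move=> wr; rewrite -{1 2}wr; apply: square_factorP; rewrite ?wr.
split=> hr2; split.
- rewrite /npowers (_ : [set _ | _] = [set nseq_tuple r (letter hk 0)]) ?cards1 //.
  apply/setP => w; rewrite !inE; apply/asboolP/eqP.
    by case/(sq _ (size_tuple w)) => wE _; apply/val_inj.
  by move=> ->; apply/sq; rewrite ?size_nseq.
- move=> w; split=> [[wr]|wE]; first by case/(sq _ wr).
  by have wr : size w = r by [rewrite wE size_nseq]; split=> //; apply/(sq _ wr).
- apply/eqP; rewrite cards_eq0; apply/eqP/setP => w; rewrite !inE.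
  by apply/asboolP => /(sq _ (size_tuple w))[_]; lia.
- by move=> w wr /(sq _ wr)[_]; lia.
Qed.
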